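(* Suppose $(\mathcal A,\mathcal T,(-),\preceq)$ is a semiring system. Let $E=\{1,\dots,n\}$, and let $A$ be an $m\times n$ matrix with entries in $\mathcal A$, with at least one maximal minor with value in $\mathcal T$. For $(i_1,\dots,i_m)\in E^m$ let $p_A(i_1,\dots,i_m)$ be the determinant of the $m\times m$ matrix consisting of the columns $i_1,\dots,i_m$ of $A$. Then the map $p_A:E^m\to\mathcal A$ is a Grassmann–Plücker map of degree $m$ with ground set $E$ and values in $(\mathcal A,\mathcal T,(-),\preceq)$.
   Context: **Systems.** Let $(\mathcal A,+,0)$ be a commutative additive monoid with a subset $\mathcal T\subset\mathcal A$, $0\notin\mathcal T$, $\mathcal T_0=\mathcal T\cup\{0\}$. $\mathcal A$ is a $\mathcal T$-gen bimodule if $\mathcal T_0$ is a multiplicative monoid with unit $1\in\mathcal T$, additively generates $\mathcal A$, and acts on $\mathcal A$ on the left with $(a_1a_2)b=a_1(a_2b)$, $0b=0$, $1b=b$, $a1=a$, $a0=0$, $a\sum b_i=\sum ab_i$ ($a,a_i\in\mathcal T_0$, $b,b_i\in\mathcal A$), and likewise on the right. A negation map is an additive isomorphism $(-):\mathcal A\to\mathcal A$ of order $\le2$ with $(-)1\in\mathcal T$ and $((-)a)b=(-)(ab)=a((-)b)$ for $a\in\mathcal T,b\in\mathcal A$ (similarly on the right). Write $b(-)c=b+((-)c)$, $b^\circ=b(-)b$, $\mathcal A^\circ=\{b^\circ\}$. A triple $(\mathcal A,\mathcal T,(-))$ is a $\mathcal T$-gen bimodule with a negation map such that $\mathcal A^\circ\cap\mathcal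 T=\emptyset$. A surpassing relation $\preceq$ is a reflexive transitive relation with: $b\preceq0\Rightarrow b=0$; $0\preceq b^\circ$; $b_i\preceq b_i'$ ($i=1,2$) implies $a_1b_1+a_2b_2\preceq a_1b_1'+a_2b_2'$ and $b_1a_1+b_2a_2\preceq b_1'a_1+b_2'a_2$ for $a_i\in\mathcal T$, and $b_1b_2\preceq b_1'b_2'$ when $\mathcal A$ carries a multiplication; $a\preceq a'$ with $a,a'\in\mathcal T_0$ implies $a=a'$. Put $\mathcal A_{\rm Null}=\{b:0\preceq b\}$. A system is a triple with a surpassing relation such that $a,a'\in\mathcal T$ and $a(-)a'\in\mathcal A_{\rm Null}$ imply $a=a'$; a semiring system is one in which $\mathcal A$ is a (doubly distributive) semiring whose multiplication restricts to the $\mathcal T_0$-actions. **Determinant.** $(-)^{k}b$ denotes $b$ for even $k$ and $(-)b$ for odd $k$; $(-)^{\mathrm{sgn}(\pi)}b$ denotes $b$ if $\pi$ is an even permutation and $(-)b$ if odd. The determinant of $(c_{i,j})$ is $\sum_{\pi\in S_m}(-)^{\mathrm{sgn}(\pi)}c_{1,\pi(1)}\cdots c_{m,\pi(m)}$. A maximal minor is some $p_A(i_1,\dots,i_m)$. **Grassmann–Plücker map.** A map $b:E^m\to\mathcal A$ is a Grassmann–Plücker map of degree $m$ if: (i) there exist $e_1,\dots,e_m\in E$ with $b(e_1,\dots,e_m)\in\mathcal T$; (ii) $b(e_1,\dots,e_m)\in\mathcal A_{\rm Null}$ whenever $e_i=e_j$ for some $i\ne j$; (iii) $b(e_{\pi(1)},\dots,e_{\pi(m)})=(-)^{\mathrm{sgn}(\pi)}b(e_1,\dots,e_m)$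 for every $\pi\in S_m$; (iv) for any $e_0,e_1,\dots,e_m,e_2',\dots,e_m'\in E$, $$\sum_{i=0}^m(-)^i\,b(e_0,e_1,\dots,e_{i-1},e_{i+1},\dots,e_m)\,b(e_i,e_2',\dots,e_m')\in\mathcal A_{\rm Null}.$$
   Formalization: The entries of the matrix A are assumed to commute pairwise (automatic if 𝒜 is commutative), and m ≥ 1; without commutation the claim fails, e.g. for the 1×2 matrix (i j) over the quaternions with ⪯ equality and 𝒯 the nonzero elements. *)

(* Defs.v *)
From HB Require Import structures.
From mathcomp Require Import all_boot all_order all_algebra all_fingroup.

Set Implicit Arguments.
Unset Strict Implicit.
Unset Printing Implicit Defensive.

Import GRing.Theory.
Local Open Scope ring_scope.

Section Systems.

(* [mul], [lact] and [ract] are total functions on [A], but the axioms only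
   constrain [mul] on T_0 x T_0, [lact] on T_0 x A and [ract] on A x T_0;
   [ract b a] is the right action of [a] on [b]. *)
Variables (A : nmodType) (T : A -> Prop) (one : A).
Variables (mul lact ract : A -> A -> A).
Variables (neg : A -> A) (surp : A -> A -> Prop).

Definition tangible0 (a : A) : Prop := a = 0 \/ T a.

Record gen_bimodule : Prop := GenBimodule {
  zero_not_tangible : ~ T 0;
  one_tangible : T one;
  tangible0_mul : forall a b, tangible0 a -> tangible0 b -> tangible0 (mul a b);
  tangible0_mulA : forall a b c, tangible0 a -> tangible0 b -> tangible0 c ->
    mul a (mul b c) = mul (mul a b) c;
  tangible0_mul1l : forall a, tangible0 a -> mul one a = a;
  tangible0_mul1r : forall a, tangible0 a -> mul a one = a;
  tangible0_gen : forall b, exists2 s : seq A,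
    (forall a, a \in s -> tangible0 a) & b = \sum_(a <- s) a;
  lact_mul : forall a1 a2 b, tangible0 a1 -> tangible0 a2 ->
    lact (mul a1 a2) b = lact a1 (lact a2 b);
  lact_0l : forall b, lact 0 b = 0;
  lact_1l : forall b, lact one b = b;
  lact_1r : forall a, tangible0 a -> lact a one = a;
  lact_0r : forall a, tangible0 a -> lact a 0 = 0;
  lact_add : forall a b1 b2, tangible0 a ->
    lact a (b1 + b2) = lact a b1 + lact a b2;
  ract_mul : forall a1 a2 b, tangible0 a1 -> tangible0 a2 ->
    ract b (mul a1 a2) = ract (ract b a1) a2;
  ract_0r : forall b, ract b 0 = 0;
  ract_1r : forall b, ract b one = b;
  ract_1l : forall a, tangible0 a -> ract one a = a;
  ract_0l : forall a, tangible0 a -> ract 0 a = 0;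
  ract_add : forall a b1 b2, tangible0 a ->
    ract (b1 + b2) a = ract b1 a + ract b2 a
}.

Record negation_map : Prop := NegationMap {
  neg_0 : neg 0 = 0;
  neg_add : forall b1 b2, neg (b1 + b2) = neg b1 + neg b2;
  neg_involutive : involutive neg;
  neg_one_tangible : T (neg one);
  neg_lactl : forall a b, T a -> lact (neg a) b = neg (lact a b);
  neg_lactr : forall a b, T a -> lact a (neg b) = neg (lact a b);
  neg_ractl : forall a b, T a -> ract (neg b) a = neg (ract b a);
  neg_ractr : forall a b, T a -> ract b (neg a) = neg (ract b a)
}.

Definition quasi_zero (b : A) : A := b + neg b.

Record triple : Prop := Triple {
  triple_bimodule : gen_bimodule;
  triple_negation : negation_map;
  triple_quasi_zero : forall b, ~ T (quasi_zero b)
}.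

(* The compatibility with a multiplication on the whole of [A] is part of
   [semiring_system]. *)
Record surpassing_relation : Prop := SurpassingRelation {
  surp_refl : forall b, surp b b;
  surp_trans : forall b1 b2 b3, surp b1 b2 -> surp b2 b3 -> surp b1 b3;
  surp_0 : forall b, surp b 0 -> b = 0;
  surp_quasi_zero : forall b, surp 0 (quasi_zero b);
  surp_lact : forall a1 a2 b1 b2 b1' b2', T a1 -> T a2 ->
    surp b1 b1' -> surp b2 b2' ->
    surp (lact a1 b1 + lact a2 b2) (lact a1 b1' + lact a2 b2');
  surp_ract : forall a1 a2 b1 b2 b1' b2', T a1 -> T a2 ->
    surp b1 b1' -> surp b2 b2' ->
    surp (ract b1 a1 + ract b2 a2) (ract b1' a1 + ract b2' a2);
  surp_tangible0 : forall a a', tangible0 a -> tangible0 a' ->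
    surp a a' -> a = a'
}.

Definition null (b : A) : Prop := surp 0 b.

Record system : Prop := System {
  system_triple : triple;
  system_surpassing : surpassing_relation;
  system_unique_negation : forall a a', T a -> T a' ->
    null (a + neg a') -> a = a'
}.

Definition signed (odd_sign : bool) (b : A) : A :=
  if odd_sign then neg b else b.

End Systems.

Record semiring_system (A : pzSemiRingType) (T : A -> Prop)
    (neg : A -> A) (surp : A -> A -> Prop) : Prop := SemiringSystem {
  semiring_system_system : system T 1 *%R *%R *%R neg surp;
  semiring_system_surp_mul : forall b1 b2 b1' b2' : A,
    surp b1 b1' -> surp b2 b2' -> surp (b1 * b2) (b1' * b2')
}.

(* [A] need not be commutative: the factors are taken in the order of the
   rows. *)
Definition determinant (A : pzSemiRingType) (neg : A -> A) (m : nat)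
    (C : 'M[A]_m) : A :=
  \sum_(s : 'S_m) signed neg s (\prod_(i < m) C i (s i)).

Definition minor_map (A : pzSemiRingType) (neg : A -> A) (m n : nat)
    (M : 'M[A]_(m, n)) (e : m.-tuple 'I_n) : A :=
  determinant neg (colsub (tnth e) M).

(* Intended for [0 < m].  In the last clause the tuple [e'] stands for
   (e'_1, e'_2, ..., e'_m), whose entry e'_1 is not used. *)
Record Grassmann_Plucker (A : pzSemiRingType) (T : A -> Prop)
    (neg : A -> A) (surp : A -> A -> Prop) (E : Type) (m : nat)
    (b : m.-tuple E -> A) : Prop := GrassmannPlucker {
  GP_tangible : exists e, T (b e);
  GP_repeated : forall (e : m.-tuple E) (i j : 'I_m), i != j ->
    tnth e i = tnth e j -> null surp (b e);
  GP_alternating : forall (e : m.-tuple E) (s : 'S_m),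
    b [tuple tnth e (s k) | k < m] = signed neg s (b e);
  GP_relation : forall (e : m.+1.-tuple E) (e' : m.-tuple E),
    null surp (\sum_(i < m.+1) signed neg (odd i)
      (b [tuple tnth e (lift i k) | k < m] *
       b [tuple if k == 0%N :> nat then tnth e i else tnth e' k | k < m]))
}.

(* Main.v *)
Require Import Defs.
From HB Require Import structures.
From mathcomp Require Import all_boot all_order all_algebra all_fingroup.

Set Implicit Arguments.
Unset Strict Implicit.
Unset Printing Implicit Defensive.

Import GRing.Theory.
Local Open Scope ring_scope.

(** Both vanishing properties come from sign-reversing involutions: if the
    terms of a sum are matched in pairs [x], [neg x], then the sum is a
    quasi-zero [P + neg P] (lemma [sum_sign_reversing]), and quasi-zeros are
    null.  Subtraction is never used, so the argument survives in a semiring.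

    - When the columns [i] and [j] coincide, composing a permutation with the
      transposition of [i] and [j] preserves its monomial in the determinant
      and flips its sign.

    - In the Grassmann-Pluecker relation, each term of the expansion is given by
      the omitted index [i], a permutation [s] for the first minor and a
      permutation [t] for the second.  The pairs [(i, s)] are the same thing
      as permutations [u] of [0, ..., m]: [u] sends [0] to [i] and the row [k],
      placed at [k + 1], to the column used by [s] in that row.  The sign
      [(-)^i (-)^s] is the sign of [u].  Now fix [t], and let [r] be the row in
      which the second minor uses the column [e_i].  The monomial contains the
      factors [M r (e (u (r + 1)))], from the first minor, and
      [M r (e (u 0))], from the second.  Both lie in row [r], so exchanging
      [u 0] and [u (r + 1)] only permutes the factors, and flips the sign.

    The alternating property is a reindexing of the determinant.  Since products
    are taken in the order of the rows, permuting columns does not disturb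
    them.  Commutation of the entries enters with the exchange of [u 0] and
    [u (r + 1)], whose factors stand in two different products. *)

(** * Products of commuting families *)

Lemma prodrM_comm (A : pzSemiRingType) (m : nat) (a b : 'I_m -> A) :
    (forall i j, GRing.comm (a i) (b j)) ->
  (\prod_i a i) * (\prod_i b i) = \prod_i (a i * b i).
Proof.
elim: m a b => [|m IHm] a b ab_comm; first by rewrite !big_ord0 mulr1.
rewrite !big_ord_recl -IHm => [|i j]; last exact: ab_comm.
have comm_b0 : GRing.comm (b ord0) (\prod_(i < m) a (lift ord0 i)).
  by apply: commr_prod => i _; apply/commr_sym/ab_comm.
by rewrite -!mulrA; congr (_ * _); rewrite !mulrA comm_b0.
Qed.

(** * Permutations of [m + 1] points *)

(** The image of [0] and the permutation induced on the remaining points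
    determine a permutation; bijectivity then follows by counting. *)
Lemma lift_perm_bij (m : nat) :
  bijective (fun p : 'I_m.+1 * 'S_m => lift_perm ord0 p.1 p.2).
Proof.
apply: inj_card_bij => [[i s] [j t] /= eq_st|].
  have eq_ij : i = j.
    by have /permP/(_ ord0) := eq_st; rewrite !lift_perm_id.
  subst j; congr (_, _); apply/permP => k.
  have /permP/(_ (lift ord0 k)) := eq_st.
  by rewrite !lift_perm_lift => /lift_inj.
by rewrite card_prod card_ord !card_Sn factS.
Qed.

Section SemiringSystem.

Variables (A : pzSemiRingType) (T : A -> Prop).
Variables (neg : A -> A) (surp : A -> A -> Prop).
Hypothesis sysA : semiring_system T neg surp.

Let surpA := system_surpassing (semiring_system_system sysA).
Let tripA := system_triple (semiring_system_system sysA).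
Let bimodA := triple_bimodule tripA.
Let negA := triple_negation tripA.

(** * Signs in a semiring with a negation map *)

(** The axioms move [neg] across products with a tangible factor only; applied
    to the unit, they make [neg] multiplication by [neg 1] on either side, and
    associativity extends the rule to all products. *)
Lemma neg_mull (x y : A) : neg x * y = neg (x * y).
Proof.
have negE z : neg z = neg 1 * z.
  by rewrite (neg_lactl negA z (one_tangible bimodA)) mul1r.
by rewrite negE -mulrA -negE.
Qed.

Lemma neg_mulr (x y : A) : x * neg y = neg (x * y).
Proof.
have negE z : neg z = z * neg 1.
  by rewrite (neg_ractr negA z (one_tangible bimodA)) mulr1.
by rewrite negE mulrA -negE.
Qed.

Lemma neg_sum (I : Type) (r : seq I) (P : pred I) (f : I -> A) :
  neg (\sum_(i <- r | P i) f i) = \sum_(i <- r | P i) neg (f i).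
Proof. exact: (big_morph neg (neg_add negA) (neg_0 negA)). Qed.

Lemma signed_sum (c : bool) (I : Type) (r : seq I) (P : pred I) (f : I -> A) :
  signed neg c (\sum_(i <- r | P i) f i)
    = \sum_(i <- r | P i) signed neg c (f i).
Proof. by case: c => //=; apply: neg_sum. Qed.

Lemma signed_addb (c d : bool) (x : A) :
  signed neg (c (+) d) x = signed neg c (signed neg d x).
Proof. by case: c d => [] [] //=; rewrite (neg_involutive negA). Qed.

Lemma signed_mul (c d : bool) (x y : A) :
  signed neg c x * signed neg d y = signed neg (c (+) d) (x * y).
Proof.
by case: c d => [] [] /=; rewrite ?neg_mull ?neg_mulr ?(neg_involutive negA).
Qed.

(** * Null elements and sign-reversing involutions *)

Lemma null_sum (I : finType) (f : I -> A) :
  (forall i, null surp (f i)) -> null surp (\sum_i f i).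
Proof.
move=> f_null; apply: big_ind => // [|x y x_null y_null].
  exact: surp_refl surpA 0.
(* Compatibility with sums is the case of unit coefficients. *)
have T1 := one_tangible bimodA.
by have := surp_lact surpA T1 T1 x_null y_null; rewrite !mul1r addr0.
Qed.

Lemma null_signed (c : bool) (x : A) :
  null surp x -> null surp (signed neg c x).
Proof.
case: c => //= x_null; have T1 := one_tangible bimodA.
(* The negation of [x] is the combination [(neg 1) x + 1 0]. *)
have := surp_lact surpA (neg_one_tangible negA) T1 x_null (surp_refl surpA 0).
by rewrite !mulr0 !addr0 neg_mull mul1r.
Qed.

(** The involution [h] exchanges the two halves cut out by [P], so the sum over
    one half is the negation of the sum over the other. *)
Lemma sum_sign_reversing (I : finType) (P : pred I) (h : I -> I) (f : I -> A) :
    involutive h -> (forall x, P (h x) = ~~ P x) ->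
    (forall x, f (h x) = neg (f x)) ->
  \sum_x f x = quasi_zero neg (\sum_(x | P x) f x).
Proof.
move=> hK P_h f_h; rewrite (bigID P) /=; congr (_ + _).
rewrite neg_sum (reindex_inj (inv_inj hK)) /=.
by apply: eq_big => x; rewrite ?f_h // P_h negbK.
Qed.

(** An involution that flips the parity of permutations and fixes the monomials
    makes the signed sum of these monomials cancel. *)
Lemma null_signed_sum (m : nat) (h : 'S_m -> 'S_m) (F : 'S_m -> A) :
    involutive h -> (forall s, odd_perm (h s) = ~~ odd_perm s) ->
    (forall s, F (h s) = F s) ->
  null surp (\sum_(s : 'S_m) signed neg s (F s)).
Proof.
move=> hK odd_h F_h; rewrite (sum_sign_reversing hK odd_h) => [|s].
  exact: surp_quasi_zero surpA _.
by rewrite F_h odd_h -addTb signed_addb.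
Qed.

(** * Maximal minors *)

Section Minors.

Variables (m n : nat) (M : 'M[A]_(m, n)).

Lemma minor_mapE (e : m.-tuple 'I_n) :
  minor_map neg M e = \sum_(s : 'S_m) signed neg s (\prod_k M k (tnth e (s k))).
Proof.
by apply: eq_bigr => s _; congr signed; apply: eq_bigr => k _; rewrite mxE.
Qed.

Lemma minor_map_repeated (e : m.-tuple 'I_n) (i j : 'I_m) :
  i != j -> tnth e i = tnth e j -> null surp (minor_map neg M e).
Proof.
move=> neq_ij eq_e; rewrite minor_mapE.
apply: (null_signed_sum (h := fun s => (s * tperm i j)%g)) => [s|s|s].
- by rewrite -mulgA tperm2 mulg1.
- by rewrite odd_permM odd_tperm neq_ij addbT.
apply: eq_bigr => k _; rewrite permM; congr (M k _).
by case: tpermP => // ->.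
Qed.

Lemma minor_map_perm (e : m.-tuple 'I_n) (s : 'S_m) :
  minor_map neg M [tuple tnth e (s k) | k < m]
    = signed neg s (minor_map neg M e).
Proof.
rewrite !minor_mapE signed_sum [RHS](reindex_inj (mulIg s)) /=.
apply: eq_bigr => t _; rewrite -signed_addb odd_permM addbC -addbA addbb addbF.
by congr signed; apply: eq_bigr => k _; rewrite tnth_mktuple permM.
Qed.

End Minors.

(** * The Grassmann-Pluecker relation *)

Section Exchange.

Variables (m n : nat) (M : 'M[A]_(m.+1, n)).
Hypothesis entries_comm : forall i j k l, GRing.comm (M i j) (M k l).
Variables (e : m.+2.-tuple 'I_n) (e' : m.+1.-tuple 'I_n).

(** The monomial indexed by [t] in the second minor and, in the first one, by
    the pair [(i, s)] such that [u = lift_perm ord0 i s]. *)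
Definition exchange_monomial (t : 'S_m.+1) (u : 'S_m.+2) : A :=
  (\prod_k M k (tnth e (u (lift ord0 k)))) *
  (\prod_k M k (if t k == 0%N :> nat then tnth e (u ord0) else tnth e' (t k))).

(** [t^-1 ord0] is the row in which the second minor uses the column that the
    first one omits. *)
Definition exchange (t : 'S_m.+1) (u : 'S_m.+2) : 'S_m.+2 :=
  (tperm ord0 (lift ord0 (t^-1 ord0)) * u)%g.

Lemma exchange_monomial_exchange (t : 'S_m.+1) (u : 'S_m.+2) :
  exchange_monomial t (exchange t u) = exchange_monomial t u.
Proof.
rewrite /exchange_monomial !prodrM_comm => [||] *; try exact: entries_comm.
set r := (t^-1)%g ord0; apply: eq_bigr => k _; rewrite !permM tpermL.
have -> : (t k == 0%N :> nat) = (k == r).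
  by rewrite -[RHS](inj_eq (@perm_inj _ t)) permKV.
have [->|neq_kr] := eqVneq k r; first by rewrite tpermR; apply: entries_comm.
rewrite tpermD ?neq_lift //.
by rewrite (inj_eq lift_inj) eq_sym.
Qed.

Lemma null_exchange_sum (t : 'S_m.+1) :
  null surp (\sum_(u : 'S_m.+2) signed neg u (exchange_monomial t u)).
Proof.
apply: (null_signed_sum (h := exchange t)) => [u|u|u].
- by rewrite /exchange mulgA tperm2 mul1g.
- by rewrite odd_permM odd_tperm neq_lift.
exact: exchange_monomial_exchange.
Qed.

(** The sign of [lift_perm ord0 i s] is the product of [(-)^i] and the sign of
    [s], so the sums over [i] and [s] merge into one over ['S_m.+2]. *)
Lemma exchange_expansion :
  \sum_(i < m.+2) signed neg (odd i)
      (minor_map neg M [tuple tnth e (lift i k) | k < m.+1] *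
       minor_map neg M
         [tuple if k == 0%N :> nat then tnth e i else tnth e' k | k < m.+1])
    = \sum_(t : 'S_m.+1) signed neg t
        (\sum_(u : 'S_m.+2) signed neg u (exchange_monomial t u)).
Proof.
under [RHS]eq_bigr => t _.
  rewrite signed_sum (reindex _ (onW_bij _ (lift_perm_bij m.+1))).
  over.
rewrite [RHS]exchange_big /=.
rewrite -(pair_bigA _ (fun i s => \sum_(t : 'S_m.+1) signed neg t
  (signed neg (lift_perm ord0 i s)
    (exchange_monomial t (lift_perm ord0 i s))))) /=.
apply: eq_bigr => i _; rewrite !minor_mapE big_distrlr signed_sum /=.
apply: eq_bigr => s _; rewrite signed_sum; apply: eq_bigr => t _.
rewrite signed_mul -!signed_addb odd_lift_perm /= addbA addbC.
congr signed; congr (_ * _); apply: eq_bigr => k _; rewrite tnth_mktuple.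
  by rewrite lift_perm_lift.
by rewrite lift_perm_id.
Qed.

End Exchange.

End SemiringSystem.

Theorem proposition8p2 (A : pzSemiRingType) (T : A -> Prop)
    (neg : A -> A) (surp : A -> A -> Prop)
    (sysA : semiring_system T neg surp)
    (m n : nat) (m_gt0 : (0 < m)%N) (M : 'M[A]_(m, n))
    (entries_comm : forall i j k l, GRing.comm (M i j) (M k l))
    (minor_tangible : exists e : m.-tuple 'I_n, T (minor_map neg M e)) :
  Grassmann_Plucker T neg surp (minor_map neg M).
Proof.
split=> //.
- exact: (minor_map_repeated sysA).
- exact: (minor_map_perm sysA).
case: m m_gt0 M entries_comm {minor_tangible} => // m _ M M_comm e e'.
rewrite (exchange_expansion sysA); apply: (null_sum sysA) => t.
exact/(null_signed sysA)/(null_exchange_sum sysA M_comm).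
Qed.
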